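(* Let $G=(X,Y,E)$ be a bipartite graph, let $d=\max_{y\in Y}\deg(y)$ (so $d\le |X|$), and let $k$ be the minimum cardinality of a set $D\subseteq X$ that dominates $Y$ (i.e. every $y\in Y$ has a neighbour in $D$). Then the number of subsets $D\subseteq X$ of cardinality $k$ dominating $Y$ (minimum cardinality red dominating sets) is $\mathcal O(d^k)$.
   Context: Graphs are finite, simple, undirected and connected. A red dominating set of a bipartite graph $G=(X,Y,E)$ is a set $D\subseteq X$ such that every $y\in Y$ is adjacent to some vertex of $D$; an MCRD set is a red dominating set of minimum cardinality. *)

(* Defs.v *)
From mathcomp Require Import all_boot.

Set Implicit Arguments.
Unset Strict Implicit.
Unset Printing Implicit Defensive.

Record sgraph := SGraph {
  vertex :> finType;
  adj : rel vertex;
  adj_sym : symmetric adj;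
  adj_irrefl : irreflexive adj
}.

Definition neighbours (G : sgraph) (v : G) : {set G} := [set u | adj v u].

Definition degree (G : sgraph) (v : G) : nat := #|neighbours v|.

(* The graph with no vertices is vacuously connected. *)
Definition connected (G : sgraph) : Prop :=
  forall u v : G, connect (@adj G) u v.

(* Either part may be empty, as happens for a one-vertex graph. *)
Definition bipartition (G : sgraph) (X Y : {set G}) : Prop :=
  [/\ X :|: Y = [set: G],
      [disjoint X & Y] &
      forall u v : G, adj u v ->
        (u \in X) && (v \in Y) || (u \in Y) && (v \in X)].

Definition red_dominating (G : sgraph) (X Y D : {set G}) : bool :=
  (D \subset X) && [forall y in Y, exists x in D, adj y x].

Definition min_red_card (G : sgraph) (X Y : {set G}) (k : nat) : Prop :=
  (exists2 D : {set G}, red_dominating X Y D & #|D| = k) /\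
  (forall D : {set G}, red_dominating X Y D -> k <= #|D|).

(* Main.v *)
Require Import Defs.
From mathcomp Require Import all_boot.

(* The proof is a branching argument giving the constant 1. A set S with fewer
   than k elements leaves some y in Y undominated, so every dominating set
   containing S also contains one of the at most d neighbours of y, none of
   which lies in S. Starting from the empty set, after k such choices the
   dominating set of size k is determined. *)

Lemma card_bigcup_leq (I T : finType) (A : {set I}) (F : I -> {set T}) (m : nat) :
  (forall i, i \in A -> #|F i| <= m) ->
  #|\bigcup_(i in A) F i| <= #|A| * m.
Proof.
move=> leFm; rewrite -sum_nat_const.
apply: (@leq_trans (\sum_(i in A) #|F i|)); last exact: leq_sum.
elim/big_ind2: _ => // [|m1 B m2 C leB leC]; first by rewrite cards0.
by rewrite (leq_trans (leq_card_setU B C)) ?leq_add.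
Qed.

(** [n] counts the choices still to be made. The induction on [n] keeps [S] general, since each
    choice enlarges it. *)
Lemma card_min_red_supsets (G : sgraph) (X Y : {set G}) (k n : nat) (S : {set G}) :
  (forall D : {set G}, red_dominating X Y D -> k <= #|D|) ->
  #|S| + n = k ->
  #|[set D : {set G} | [&& red_dominating X Y D, #|D| == k & S \subset D]]|
    <= (\max_(y in Y) degree y) ^ n.
Proof.
move=> min_k; elim: n S => [|n IHn] S cardS.
  (* Here [S] already has [k] elements, so the only possible [D] is [S] itself. *)
  rewrite expn0 -(cards1 S); apply: subset_leq_card; apply/subsetP => D.
  rewrite !inE => /and3P[_ /eqP cardD sSD].
  by rewrite eq_sym eqEcard sSD cardD -cardS addn0 /=.
have [sSX|nsSX] := boolP (S \subset X); last first.
  rewrite (_ : [set D | _] = set0) ?cards0 //; apply/setP => D; rewrite !inE.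
  apply/negP => /and3P[/andP[sDX _] _ sSD].
  by rewrite (subset_trans sSD sDX) in nsSX.
(* Otherwise [S] would be red dominating with fewer than [k] elements. *)
have /forall_inPn[y yY undom] : ~~ [forall y in Y, exists x in S, adj y x].
  apply/negP => domS; have := min_k S; rewrite /red_dominating sSX domS.
  by rewrite -cardS -{2}[#|S|]addn0 leq_add2l => /(_ isT).
pose F x := [set D : {set G} |
  [&& red_dominating X Y D, #|D| == k & x |: S \subset D]].
apply: (@leq_trans #|\bigcup_(x in neighbours y) F x|).
  apply/subset_leq_card/subsetP => D; rewrite inE => /and3P[domD cardD sSD].
  have /andP[_ /forall_inP/(_ y yY)/exists_inP[x xD yx]] := domD.
  by apply/bigcupP; exists x; rewrite !inE // domD cardD subUset sub1set xD.
apply: leq_trans (_ : degree y * (\max_(z in Y) degree z) ^ n <= _); last first.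
  by rewrite expnS leq_mul2r leq_bigmax_cond ?orbT.
apply: card_bigcup_leq => x; rewrite inE => yx; apply: IHn.
(* Freshness of [x] makes [x |: S] exactly one element larger, so the size equation holds again with
   [n] choices left. *)
have xnS : x \notin S.
  by apply: contra undom => xS; apply/exists_inP; exists x.
by rewrite cardsU1 xnS -cardS addnS.
Qed.

Lemma neighbours_sub_red (G : sgraph) (X Y : {set G}) (y : G) :
  bipartition X Y -> y \in Y -> neighbours y \subset X.
Proof.
case=> _ disjXY bip yY; apply/subsetP => u; rewrite inE => /bip.
by rewrite (disjointFl disjXY yY) yY => /andP[].
Qed.

Theorem theorem2 :
  exists C : nat,
    forall (G : sgraph) (X Y : {set G}) (d k : nat),
      connected G ->
      bipartition X Y ->
      d = \max_(y in Y) degree y ->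
      min_red_card X Y k ->
      d <= #|X| /\
      #|[set D : {set G} | red_dominating X Y D && (#|D| == k)]| <= C * d ^ k.
Proof.
exists 1 => G X Y d k _ bip -> [_ min_k]; split.
  by apply/bigmax_leqP => y yY; apply/subset_leq_card/(neighbours_sub_red _ _ _ _ bip yY).
(* All [k] choices remain at the empty set, which every [D] contains. If [Y] is empty, then [d] and
   [k] are both 0 and the bound is [0 ^ 0 = 1]. *)
rewrite mul1n; have := card_min_red_supsets G X Y k k set0 min_k.
rewrite cards0 => /(_ erefl); apply: leq_trans; apply/subset_leq_card/subsetP => D.
by rewrite !inE sub0set andbT.
Qed.
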